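(* Let $Y=\beta+\sigma\xi\in\mathbb{R}^p$ with $\beta\in\mathbb{R}^p$ unknown, $\sigma>0$ and $\xi\sim\mathcal{N}(0,\mathbb{I}_p)$. Let $q\ge1$, $s<p/4$, and let $\hat\beta^s$ be the estimator $\hat\beta^s_j:=Y_j\mathbf{1}\{|Y_j|\ge t^*_s\}$, $j=1,\dots,p$, where $t^*_s:=\sqrt{2\sigma^2\log(p/s-1)+\sigma^2q\log\log(p/s-1)}$. Then for all $a>0$, $$\sup_{\beta\in\Omega^p_{s,a}}\mathbf{E}_\beta\big(\|\hat\beta^s-\beta\|_q^q\big)\ \le\ C_q\,\Phi_{ad}(a),$$ where $C_q$ is a constant depending only on $q$.
   Context: $\Omega^p_{s,a}=\{\beta\in\mathbb{R}^p:\ |\beta|_0\le s\ \text{and}\ |\beta_i|\ge a\ \forall i\in S_\beta\}$, where $|\beta|_0$ is the number of nonzero entries and $S_\beta$ the set of indices of nonzero entries; $\mathbf{E}_\beta$ is expectation when the true parameter is $\beta$; $\|\cdot\|_q$ is the $\ell_q$ norm. $\sigma_q:=(\mathbf{E}|\zeta|^q)^{1/q}$ for $\zeta\sim\mathcal{N}(0,\sigma^2)$. $a_q(1):=\sqrt{2\sigma^2\log(\frac ps-1)+q\sigma^2\log\log(\frac ps-1)}+\sqrt{q\sigma^2\log\log(\frac ps-1)}$. Define $\Phi_{ad}(a):=\sigma_q^qs$ if $a\ge a_q(1)$, and $\Phi_{ad}(a):=s\sigma^q(2\log(\frac ps-1))^{q/2}$ otherwise. *)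

(* Defs.v *)
From HB Require Import structures.
From mathcomp Require Import all_boot all_order all_algebra.
From mathcomp Require Import all_classical all_reals all_analysis.
Set Implicit Arguments. Unset Strict Implicit. Unset Printing Implicit Defensive.
Import Order.TTheory GRing.Theory Num.Theory.
Local Open Scope classical_set_scope.
Local Open Scope ring_scope.

Definition supp {R : realType} (p : nat) (beta : 'I_p -> R) : {set 'I_p} :=
  [set j : 'I_p | beta j != 0].

Definition Omega {R : realType} (p s : nat) (a : R) : set ('I_p -> R) :=
  [set beta : 'I_p -> R | (#|supp beta| <= s)%N /\
              (forall j, beta j != 0 :> R -> a <= `|beta j|)].

Definition mutually_independent {R : realType} d (T : measurableType d)
  (P : probability T R) (p : nat) (X : 'I_p -> {RV P >-> R}) : Prop :=
  forall (J : {set 'I_p}) (B : 'I_p -> set R),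
    (forall j, measurable (B j)) ->
    P (\bigcap_(j in [set j | j \in J]) (X j @^-1` B j)) =
    (\prod_(j in J) P (X j @^-1` B j))%E.

Definition tstar {R : realType} (p s : nat) (sigma q : R) : R :=
  Num.sqrt (2 * sigma ^+ 2 * ln (p%:R / s%:R - 1)
            + sigma ^+ 2 * q * ln (ln (p%:R / s%:R - 1))).

Definition hard_thr {R : realType} (t y : R) : R :=
  if t <= `|y| then y else 0.

Definition aq1 {R : realType} (p s : nat) (sigma q : R) : R :=
  Num.sqrt (2 * sigma ^+ 2 * ln (p%:R / s%:R - 1)
            + q * sigma ^+ 2 * ln (ln (p%:R / s%:R - 1)))
  + Num.sqrt (q * sigma ^+ 2 * ln (ln (p%:R / s%:R - 1))).

(* sigma_q^q = E|zeta|^q, zeta ~ N(0, sigma^2) (normal_prob takes the std dev) *)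
Definition sigma_qq {R : realType} (sigma q : R) : \bar R :=
  (\int[normal_prob 0 sigma]_x (`|x| `^ q)%:E)%E.

Definition Phi_ad {R : realType} (p s : nat) (sigma q a : R) : \bar R :=
  if aq1 p s sigma q <= a then (s%:R%:E * sigma_qq sigma q)%E
  else (s%:R * sigma `^ q * (2 * ln (p%:R / s%:R - 1)) `^ (q / 2))%:E.

(* Main.v *)
(** With [M = p/s - 1 > 3] and [L = ln M >= 1], the threshold is [sigma * t] where
    [t^2 = 2 L + q ln L], so that [exp (- t^2 / 2) = M^-1 L^(- q / 2)].

    A null coordinate costs [sigma^q E (|xi|^q ; |xi| >= t)], which is of order
    [sigma^q t^q exp (- t^2 / 2)], that is [sigma^q / M]; the at most [p] of them
    contribute [sigma^q s] since [p / M <= 2 s].  A nonzero coordinate costs at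
    most a constant times [sigma^q (1 + t^q) ~ sigma^q L^(q / 2)].  If moreover
    its signal exceeds the threshold by [sigma r] with [r^2 = q ln L], it is
    killed only when [|xi| >= r], an event of probability at most a constant
    times [L^(- q / 2)], which cancels the factor [t^q]. *)

Require Import Defs.
From HB Require Import structures.
From mathcomp Require Import all_boot all_order all_algebra.
From mathcomp Require Import all_classical all_reals all_analysis.
From mathcomp Require Import measurable_realfun ring lra.
Set Implicit Arguments.
Unset Strict Implicit.
Import Order.TTheory GRing.Theory Num.Theory.
Local Open Scope classical_set_scope.
Local Open Scope ring_scope.

(** * Power inequalities *)

Lemma powRD_le (R : realType) (q x y : R) : 0 <= q -> 0 <= x -> 0 <= y ->
  (x + y) `^ q <= 2 `^ q * (x `^ q + y `^ q).
Proof.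
move=> q0; wlog xy : x y / x <= y => [H x0 y0|x0 y0].
  have /orP[xy|yx] := le_total x y; first exact: H.
  by rewrite addrC (addrC (x `^ q)); exact: H.
apply: (@le_trans _ _ ((2 * y) `^ q)).
  by apply: ge0_ler_powR; rewrite // ?nnegrE ?addr_ge0 ?mulr_ge0//; lra.
by rewrite powRM// ler_wpM2l ?powR_ge0// lerDr powR_ge0.
Qed.

Lemma powR1D_le_expR (R : realType) (q u : R) : 0 <= q -> 0 <= u ->
  (1 + u) `^ q <= expR (q * u).
Proof.
move=> q0 u0; have u1 : 0 < 1 + u by lra.
by rewrite /powR gt_eqF// ler_expR ler_wpM2l// le_ln1Dx//; lra.
Qed.

(** * Gaussian densities, truncated moments and a lower bound on absolute moments *)

Lemma normal_pdf01E (R : realType) (x : R) :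
  normal_pdf 0 1 x = normal_peak 1 * expR (- (x ^+ 2 / 2)).
Proof.
rewrite normal_pdfE ?oner_eq0// /normal_fun subr0 expr1n; congr (_ * expR _).
by lra.
Qed.

Lemma normal_pdf2E (R : realType) (m x : R) :
  normal_pdf m 2 x = normal_peak 1 / 2 * expR (- ((x - m) ^+ 2 / 8)).
Proof.
rewrite normal_pdfE// /normal_peak /normal_fun; congr (_ * expR _); last first.
  by rewrite -mulr_natr; lra.
rewrite -mulrnAr sqrtrM ?sqr_ge0// sqrtr_sqr ger0_norm// invfM mulrC expr1n.
by rewrite mul1r.
Qed.

(* Tilting to mean [r] extracts [exp (- r^2 / 2)]; widening the standard
   deviation from 1 to 2 absorbs the polynomial factor. *)
Lemma powR_normal_pdf_le (R : realType) (q r x : R) : 0 <= q -> 0 <= r ->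
  r <= x -> x `^ q * normal_pdf 0 1 x <=
  2 * expR (q ^+ 2) * (1 + r) `^ q * expR (- (r ^+ 2 / 2)) * normal_pdf r 2 x.
Proof.
move=> q0 r0 rx; rewrite normal_pdf01E normal_pdf2E.
(* Uses [x <= (1 + r) * (1 + (x - r))], then [1 + u <= expR u] for the excess [u = x - r]. *)
have xq : x `^ q <= (1 + r) `^ q * expR (q * (x - r)).
  apply: (@le_trans _ _ (((1 + r) * (1 + (x - r))) `^ q)).
    by apply: ge0_ler_powR; rewrite // ?nnegrE ?mulr_ge0//; nra.
  rewrite powRM; [|lra..]; rewrite ler_wpM2l ?powR_ge0// powR1D_le_expR//; lra.
(* With [u = x - r], the right exponent exceeds the left one by [(q - u / 2)^2 + u^2 / 8 + r * u], a
   sum of nonnegative terms. *)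
have E : expR (q * (x - r)) * expR (- (x ^+ 2 / 2)) <=
    expR (q ^+ 2) * expR (- (r ^+ 2 / 2)) * expR (- ((x - r) ^+ 2 / 8)).
  rewrite -!expRD ler_expR -subr_ge0.
  have : 0 <= r * (x - r) by rewrite mulr_ge0 ?subr_ge0.
  have : 0 <= (q - (x - r) / 2) ^+ 2 by exact: sqr_ge0.
  have : 0 <= (x - r) ^+ 2 by exact: sqr_ge0.
  nra.
have P0 := normal_peak_ge0 (1 : R); set P := normal_peak 1 in P0 *.
have -> (A B C D : R) : 2 * A * B * C * (P / 2 * D) = P * (B * (A * C * D)).
  by field.
rewrite mulrCA ler_wpM2l//.
apply: (le_trans (ler_wpM2r (expR_ge0 _) xq)).
by rewrite -[leLHS]mulrA ler_wpM2l ?powR_ge0.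
Qed.

(** The Radon-Nikodym derivative of the Gaussian law and the explicit density integrate to the same
    value on every measurable set, so they agree almost everywhere. *)
Lemma ge0_integral_normal_prob (R : realType) (m s : R) (f : R -> \bar R) :
  measurable_fun setT f -> (forall x, 0 <= f x)%E ->
  (\int[normal_prob m s]_x f x =
   \int[lebesgue_measure]_x (f x * (normal_pdf m s x)%:E))%E.
Proof.
move=> mf f0.
have dom := @normal_prob_dominates R m s.
rewrite -(Radon_Nikodym_SigmaFinite.change_of_variables dom)//.
apply: ae_eq_integral => //.
- apply: emeasurable_funM => //.
  exact: measurable_int (Radon_Nikodym_SigmaFinite.f_integrable dom).
- apply: emeasurable_funM => //; apply/measurable_EFinP.
  exact: measurable_normal_pdf.
- apply: ae_eqe_mul2l; apply: integral_ae_eq => //.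
  + exact: Radon_Nikodym_SigmaFinite.f_integrable.
  + apply/measurable_EFinP; exact: measurable_normal_pdf.
  + by move=> E _ mE; rewrite -Radon_Nikodym_SigmaFinite.f_integral.
Qed.

(** One function for three uses: [r = 0] gives the full absolute moment, [q = 0] the indicator of
    the tail (since [powR 0 0 = 1]), and general [q], [r] the truncated moment paid by null
    coordinates. *)
Definition tail_pow (R : realType) (q r x : R) : R :=
  if r <= `|x| then `|x| `^ q else 0.

Lemma tail_pow_ge0 (R : realType) (q r x : R) : 0 <= tail_pow q r x.
Proof. by rewrite /tail_pow; case: ifP => // _; exact: powR_ge0. Qed.

Lemma measurable_tail_pow (R : realType) (q r : R) :
  measurable_fun setT (tail_pow q r).
Proof.
apply: measurable_fun_ifT => //.
- by apply: measurable_fun_ler => //; exact: normr_measurable.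
- apply: (measurableT_comp (measurable_powR q)); exact: normr_measurable.
Qed.

(** The two tails are dominated by multiples of the densities centred at [r] and [- r] with standard
    deviation 2. Each has mass one, which doubles the pointwise constant 2 to 4. *)
Lemma integral_tail_pow_le (R : realType) (q r : R) : 0 <= q -> 0 <= r ->
  (\int[normal_prob 0%R 1%R]_x (tail_pow q r x)%:E <=
   (4 * expR (q ^+ 2) * (1 + r) `^ q * expR (- (r ^+ 2 / 2)))%:E)%E.
Proof.
move=> q0 r0; rewrite ge0_integral_normal_prob//; last 2 first.
- apply/measurable_EFinP; exact: measurable_tail_pow.
- by move=> x; rewrite lee_fin tail_pow_ge0.
set c : R := 2 * expR (q ^+ 2) * (1 + r) `^ q * expR (- (r ^+ 2 / 2)).
have c0 : 0 <= c by rewrite !mulr_ge0 ?expR_ge0 ?powR_ge0.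
pose g (x : R) := c * normal_pdf r 2 x + c * normal_pdf (- r) 2 x.
have mpdf m : measurable_fun setT (fun x : R => (normal_pdf m 2 x)%:E).
  apply/measurable_EFinP; exact: measurable_normal_pdf.
apply: (@le_trans _ _ (\int[lebesgue_measure]_x (g x)%:E)%E).
  apply: ge0_le_integral => //.
  - by move=> x _; rewrite -EFinM lee_fin mulr_ge0 ?tail_pow_ge0 ?normal_pdf_ge0.
  - apply: emeasurable_funM; apply/measurable_EFinP.
      exact: measurable_tail_pow.
    exact: measurable_normal_pdf.
  - apply/measurable_EFinP; apply: measurable_funD;
      by apply: measurable_funM => //; exact: measurable_normal_pdf.
  - move=> x _; rewrite -EFinM lee_fin /g /tail_pow.
    have p0 m (y : R) : 0 <= c * normal_pdf m 2 y.
      by rewrite mulr_ge0 ?normal_pdf_ge0.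
    case: ifPn => [rx|_]; last by rewrite mul0r addr_ge0.
    have [x0|x0] := leP 0 x.
      rewrite ger0_norm// in rx *; apply: le_trans (powR_normal_pdf_le q0 r0 rx) _.
      by rewrite lerDl.
    rewrite ltr0_norm// in rx *.
    have -> : normal_pdf 0 1 x = normal_pdf 0 1 (- x).
      by rewrite !normal_pdf01E sqrrN.
    apply: le_trans (powR_normal_pdf_le q0 r0 rx) _.
    have -> : normal_pdf r 2 (- x) = normal_pdf (- r) 2 x.
      by rewrite !normal_pdf2E -opprD sqrrN opprK.
    by rewrite lerDr.
under eq_integral do rewrite /g EFinD !EFinM.
rewrite ge0_integralD//; last 4 first.
- by move=> x _; rewrite -EFinM lee_fin mulr_ge0 ?normal_pdf_ge0.
- by apply: emeasurable_funM => //; exact: mpdf.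
- by move=> x _; rewrite -EFinM lee_fin mulr_ge0 ?normal_pdf_ge0.
- by apply: emeasurable_funM => //; exact: mpdf.
have Zpdf m : (\int[lebesgue_measure]_x (c%:E * (normal_pdf m 2 x)%:E) = c%:E)%E.
  rewrite ge0_integralZl ?lee_fin//.
  - by rewrite integral_normal_pdf mule1.
  - exact: mpdf.
  - by move=> x _; rewrite lee_fin normal_pdf_ge0.
by rewrite !Zpdf -EFinD lee_fin /c; lra.
Qed.

Lemma sigma_qq_ge (R : realType) (q s : R) : 0 <= q -> 0 < s ->
  ((2^-1 * (s / 2) `^ q)%:E <= sigma_qq s q)%E.
Proof.
move=> q0 s0; rewrite /sigma_qq.
pose A : set R := `]- (s / 2), (s / 2)[%classic.
have mA : measurable A by exact: measurable_itv.
have sn0 : s != 0 by rewrite gt_eqF.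
(* The peak is the inverse of [sqrt (2 * pi * s^2)], and [pi >= 2] bounds that root below by
   [2 * s]. *)
have pk : normal_peak s <= (2 * s)^-1.
  rewrite /normal_peak lef_pV2 ?posrE ?mulr_gt0//; last first.
    by rewrite sqrtr_gt0 mulrn_wgt0// mulr_gt0 ?pi_gt0// exprn_gt0.
  rewrite -[leLHS]gtr0_norm ?mulr_gt0// -sqrtr_sqr; apply: ler_wsqrtr.
  have := pi_ge2 R; have : 0 < s ^+ 2 by rewrite exprn_gt0.
  by rewrite exprMn -mulr_natr; nra.
have PA : (normal_prob 0%R s A <= (2^-1 : R)%:E)%E.
  apply: (@le_trans _ _ (\int[lebesgue_measure]_(x in A) (cst (2 * s)^-1%:E) x)%E).
    apply: ge0_le_integral => //.
    - by move=> x _; rewrite lee_fin normal_pdf_ge0.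
    - apply/measurable_funTS/measurable_EFinP; exact: measurable_normal_pdf.
    - by move=> x _; rewrite lee_fin (le_trans _ pk)// normal_pdf_ub.
  rewrite integral_cst//= lebesgue_measure_itv/= lte_fin ifT; last by lra.
  rewrite -EFinD -EFinM lee_fin.
  by rewrite (_ : s / 2 - - (s / 2) = s); [rewrite invfM -mulrA mulVf// mulr1|lra].
have PAC : ((2^-1 : R)%:E <= normal_prob 0%R s (~` A))%E.
  have fA : normal_prob 0%R s A \is a fin_num by exact: fin_num_measure.
  have /= -> := probability_setC (normal_prob 0 s) mA.
  by move: PA; rewrite -(fineK fA) -EFinB !lee_fin; lra.
apply: (@le_trans _ _ (\int[normal_prob 0%R s]_(x in ~` A) (cst ((s / 2) `^ q)%:E) x)%E).
  rewrite integral_cst//; last exact: measurableC.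
  by rewrite EFinM muleC lee_wpmul2l// lee_fin powR_ge0.
have mp : measurable_fun setT (fun x : R => (`|x| `^ q)%:E).
  apply/measurable_EFinP/(measurableT_comp (measurable_powR q)).
  exact: normr_measurable.
apply: (@le_trans _ _ (\int[normal_prob 0%R s]_(x in ~` A) (`|x| `^ q)%:E)%E).
  apply: ge0_le_integral => //.
  - exact: measurableC.
  - by move=> x _; rewrite lee_fin powR_ge0.
  - exact: measurable_funTS.
  - move=> x /= Ax; rewrite lee_fin; apply: ge0_ler_powR; rewrite ?nnegrE//; first lra.
    rewrite leNgt; apply/negP => xs; apply: Ax.
    by rewrite /A/= in_itv/= -ltr_norml.
apply: ge0_subset_integral => //; exact: measurableC.
Qed.

(** * Pointwise loss of hard thresholding *)

Lemma hard_thr0_powE (R : realType) (q s t x : R) : 0 < q -> 0 < s ->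
  `|hard_thr (s * t) (0 + s * x) - 0| `^ q = s `^ q * tail_pow q t x.
Proof.
move=> q0 s0; rewrite add0r subr0 /hard_thr /tail_pow normrM gtr0_norm//.
rewrite ler_pM2l//; case: ifP => _; last by rewrite normr0 powR0 ?gt_eqF// mulr0.
by rewrite normrM gtr0_norm// powRM// ltW.
Qed.

(* When the signal exceeds the threshold by [s * r], killing it forces the noise
   to deviate by at least [r]; [r <= 0] is the case of no assumption on [b]. *)
Lemma hard_thr_pow_le (R : realType) (q s t r b x : R) : 0 <= q -> 0 < s ->
  0 <= t -> r <= 0 \/ s * t + s * r <= `|b| ->
  `|hard_thr (s * t) (b + s * x) - b| `^ q <=
  2 `^ q * s `^ q * (tail_pow q 0 x + t `^ q * tail_pow 0 r x).
Proof.
move=> q0 s0 t0 rb; rewrite /tail_pow normr_ge0 powRr0 /hard_thr.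
have ind0 : 0 <= t `^ q * (if r <= `|x| then 1 else 0).
  by rewrite mulr_ge0 ?powR_ge0//; case: ifP.
have two1 : 1 <= 2 `^ q :> R by rewrite -[leLHS](powRr0 2); apply: ler_powR => //; lra.
(* A kept coordinate loses only the noise [s * x]; a killed one loses [b], and then
   [|b| < s * t + s * |x|]. *)
case: (leP (s * t) `|b + s * x|) => [_|tx].
  rewrite addrAC subrr add0r normrM gtr0_norm// powRM// ?(ltW s0)// -mulrA.
  rewrite -[leLHS]mul1r ler_pM// ?mulr_ge0 ?powR_ge0//.
  by rewrite ler_wpM2l ?powR_ge0// lerDl.
have bx : `|b| <= `|b + s * x| + s * `|x|.
  rewrite -[in leLHS](addrK (s * x) b) (le_trans (ler_normB _ _))//.
  by rewrite normrM (gtr0_norm s0).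
have -> : (r <= `|x|) = true.
  case: rb => [r0|rb]; first exact: le_trans (normr_ge0 x).
  by rewrite -(ler_pM2l s0); lra.
rewrite sub0r normrN mulr1 -mulrA addrC mulrDr -!powRM// ?(ltW s0)//.
apply: (@le_trans _ _ ((s * t + s * `|x|) `^ q)).
  apply: ge0_ler_powR; rewrite ?nnegrE ?addr_ge0 ?mulr_ge0 ?(ltW s0)//.
  by apply: le_trans bx _; lra.
by apply: powRD_le => //; rewrite mulr_ge0// ltW.
Qed.

(** * Risk of one coordinate, then of the whole vector *)

Section coordinate_risk.
Context {R : realType} {d : measure_display} {T : measurableType d}.
Variables (P : probability T R) (X : {RV P >-> R}).
Hypothesis dX : distribution P X = normal_prob 0 1 :> (set R -> \bar R).

Lemma integral_normal_RV (f : R -> R) : measurable_fun setT f ->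
  (forall x, 0 <= f x) ->
  (\int[P]_w (f (X w))%:E = \int[normal_prob 0%R 1%R]_x (f x)%:E)%E.
Proof.
move=> mf f0; have mX : measurable_fun setT (X : T -> measurableTypeR R).
  exact: (measurable_funP X).
have mEf : measurable_fun [set: measurableTypeR R] (EFin \o f).
  by apply/measurable_EFinP.
rewrite -(ge0_integral_pushforward mX P measurableT mEf); last first.
  by move=> x _; rewrite lee_fin.
apply: (eq_measure_integral (normal_prob 0 1)) => A mA _.
by transitivity (distribution P X A); last rewrite dX.
Qed.

Lemma measurable_hard_thr_loss (q s t b : R) :
  measurable_fun setT (fun w => `|hard_thr t (b + s * X w) - b| `^ q).
Proof.
have mY : measurable_fun setT (fun w => b + s * X w).
  by apply: measurable_funD => //; exact: measurable_funM.
apply: (measurableT_comp (measurable_powR q)).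
apply: measurableT_comp; first exact: normr_measurable.
apply: measurable_funB => //; apply: measurable_fun_ifT => //.
by apply: measurable_fun_ler => //; exact: measurableT_comp.
Qed.

Lemma null_risk_le (q s t : R) : 0 < q -> 0 < s -> 0 <= t ->
  (\int[P]_w (`|hard_thr (s * t) (0 + s * X w) - 0| `^ q)%:E <=
   (s `^ q * (4 * expR (q ^+ 2) * (1 + t) `^ q * expR (- (t ^+ 2 / 2))))%:E)%E.
Proof.
move=> q0 s0 t0; under eq_integral do rewrite hard_thr0_powE// EFinM.
have mX : measurable_fun setT (fun w => (tail_pow q t (X w))%:E).
  by apply/measurable_EFinP/measurableT_comp => //; exact: measurable_tail_pow.
rewrite ge0_integralZl ?lee_fin ?powR_ge0//; last first.
  by move=> w _; rewrite lee_fin tail_pow_ge0.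
rewrite (integral_normal_RV (f := tail_pow q t)); last 2 first.
- exact: measurable_tail_pow.
- exact: tail_pow_ge0.
rewrite [leRHS]EFinM lee_wpmul2l ?lee_fin ?powR_ge0//.
by apply: integral_tail_pow_le => //; exact: ltW.
Qed.

(** Integrating the pointwise bound leaves a full moment (truncation level 0) and the probability of
    a deviation of at least [r] (exponent 0). Both are instances of [integral_tail_pow_le]. *)
Lemma signal_risk_le (q s t r b : R) : 0 <= q -> 0 < s -> 0 <= t -> 0 <= r ->
  r = 0 \/ s * t + s * r <= `|b| ->
  (\int[P]_w (`|hard_thr (s * t) (b + s * X w) - b| `^ q)%:E <=
   (2 `^ q * s `^ q *
    (4 * expR (q ^+ 2) + t `^ q * (4 * expR (- (r ^+ 2 / 2)))))%:E)%E.
Proof.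
move=> q0 s0 t0 r0 rb.
pose f x := 2 `^ q * s `^ q * (tail_pow q 0 x + t `^ q * tail_pow 0 r x).
have tp0 := @tail_pow_ge0 R.
have c0 : 0 <= 2 `^ q * s `^ q by rewrite mulr_ge0 ?powR_ge0.
have f0 x : 0 <= f x by rewrite mulr_ge0// addr_ge0// mulr_ge0 ?powR_ge0.
have mf : measurable_fun setT f.
  apply: measurable_funM => //; apply: measurable_funD.
    exact: measurable_tail_pow.
  by apply: measurable_funM => //; exact: measurable_tail_pow.
apply: (@le_trans _ _ (\int[P]_w (f (X w))%:E)%E).
  apply: ge0_le_integral => //.
  - by apply/measurable_EFinP; exact: measurable_hard_thr_loss.
  - by apply/measurable_EFinP; exact: measurableT_comp.
  - move=> w _; rewrite lee_fin; apply: hard_thr_pow_le => //.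
    by case: rb => [->|]; [left|right].
rewrite integral_normal_RV// /f.
have mt (k u : R) : measurable_fun setT (fun x : R => (tail_pow k u x)%:E).
  by apply/measurable_EFinP; exact: measurable_tail_pow.
under eq_integral do rewrite EFinM EFinD (EFinM (t `^ q)).
rewrite ge0_integralZl ?lee_fin//; last 2 first.
- apply: emeasurable_funD; first exact: mt.
  by apply: emeasurable_funM => //; exact: mt.
- by move=> x _; rewrite adde_ge0 ?mule_ge0 ?lee_fin ?powR_ge0.
rewrite ge0_integralD//; last 4 first.
- by move=> x _; rewrite lee_fin.
- exact: mt.
- by move=> x _; rewrite mule_ge0 ?lee_fin ?powR_ge0.
- by apply: emeasurable_funM => //; exact: mt.
rewrite ge0_integralZl ?lee_fin ?powR_ge0//; last 2 first.
- exact: mt.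
- by move=> x _; rewrite lee_fin.
rewrite [leRHS]EFinM lee_wpmul2l ?lee_fin// EFinD leeD//.
  apply: le_trans (integral_tail_pow_le q0 (lexx 0)) _.
  by rewrite addr0 powR1 expr0n/= mul0r oppr0 expR0 !mulr1.
rewrite [leRHS]EFinM lee_wpmul2l ?lee_fin ?powR_ge0//.
apply: le_trans (integral_tail_pow_le (lexx 0) r0) _.
by rewrite powRr0 expr0n/= expR0 !mulr1.
Qed.

End coordinate_risk.

Lemma total_risk_le (R : realType) (p s : nat) (q sigma t r : R)
    (d : measure_display) (T : measurableType d) (P : probability T R)
    (xi : 'I_p -> {RV P >-> R}) (beta : 'I_p -> R) :
  (forall j, distribution P (xi j) = normal_prob 0 1 :> (set R -> \bar R)) ->
  0 < q -> 0 < sigma -> 0 <= t -> 0 <= r -> (#|supp beta| <= s)%N ->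
  (forall j, beta j != 0 -> r = 0 \/ sigma * t + sigma * r <= `|beta j|) ->
  (\int[P]_w (\sum_(j < p)
      `|hard_thr (sigma * t) (beta j + sigma * xi j w) - beta j| `^ q)%:E <=
   (p%:R * (sigma `^ q *
      (4 * expR (q ^+ 2) * (1 + t) `^ q * expR (- (t ^+ 2 / 2)))) +
    s%:R * (2 `^ q * sigma `^ q *
      (4 * expR (q ^+ 2) + t `^ q * (4 * expR (- (r ^+ 2 / 2))))))%:E)%E.
Proof.
move=> dxi q0 sg0 t0 r0 bs br.
set e0 := sigma `^ q * _; set e1 := 2 `^ q * sigma `^ q * _.
have e00 : 0 <= e0 by rewrite !mulr_ge0 ?powR_ge0 ?expR_ge0 ?addr_ge0.
have e10 : 0 <= e1.
  by rewrite mulr_ge0 ?addr_ge0 ?mulr_ge0 ?powR_ge0 ?expR_ge0.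
under eq_integral do rewrite -sumEFin.
rewrite ge0_integral_sum//; last first.
  move=> j; apply/measurable_EFinP; exact: measurable_hard_thr_loss.
(* The null cost [e0] is charged to every coordinate, even the nonzero ones, so that the sum splits
   into [p] copies of [e0] and at most [s] copies of [e1]. *)
apply: (@le_trans _ _ (\sum_(j < p) (e0 + (if beta j != 0 then e1 else 0))%:E)%E).
  apply: lee_sum => j _; have [bj0|bj0] := eqVneq (beta j) 0.
    by rewrite bj0 addr0; exact: null_risk_le.
  apply: (@le_trans _ _ e1%:E); last by rewrite lee_fin lerDr.
  by apply: signal_risk_le => //; [exact: ltW | exact: br].
rewrite sumEFin lee_fin big_split/= sumr_const card_ord mulr_natl lerD2l.
rewrite -big_mkcond/= sumr_const -[leLHS]mulr_natl ler_wpM2r// ler_nat.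
by apply: leq_trans bs; rewrite /supp cardsE.
Qed.

(** * Size of the threshold and calibration of the bounds *)

Lemma expR1_le3 (R : realType) : expR 1 <= 3 :> R.
Proof.
(* [6/5 ^ 6 < 3] *)
have h : expR (6^-1) <= 6 / 5 :> R.
  have := expR_ge1Dx (- 6^-1 : R); rewrite expRN.
  have e0 := expR_gt0 (6^-1 : R); rewrite -(ler_pM2l e0) mulfV ?gt_eqF//.
  by lra.
have -> : 1 = 6^-1 * 6%:R :> R by rewrite mulVf.
rewrite expRM_natr; apply: (@le_trans _ _ ((6 / 5) ^+ 6)); last by lra.
by rewrite lerXn2r ?nnegrE ?expR_ge0//; lra.
Qed.

(** Applied to [p / s - 1 > 3]: it gives [L >= 1], hence [ln L >= 0], so the square roots in the
    threshold have nonnegative arguments. *)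
Lemma ln_ge1 (R : realType) (x : R) : 3 <= x -> 1 <= ln x.
Proof.
move=> x3; rewrite -(expRK 1) ler_ln ?posrE ?expR_gt0//; last lra.
exact: le_trans (expR1_le3 R) x3.
Qed.

Lemma sqrt_powR (R : realType) (x q : R) : 0 <= x ->
  Num.sqrt x `^ q = x `^ (q / 2).
Proof. by move=> x0; rewrite -powR12_sqrt// -powRrM mulrC. Qed.

Lemma expR_half_ln (R : realType) (x q : R) : 0 < x ->
  expR (- (q * ln x / 2)) = (x `^ (q / 2))^-1.
Proof. by move=> x0; rewrite /powR gt_eqF// expRN; congr (expR _)^-1; lra. Qed.

Definition std_threshold {R : realType} (q L : R) : R :=
  Num.sqrt (2 * L + q * ln L).

Lemma tstarE (R : realType) (p s : nat) (sigma q : R) (L := ln (p%:R / s%:R - 1)) :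
  0 < sigma -> tstar p s sigma q = sigma * std_threshold q L.
Proof.
move=> s0; rewrite /tstar /std_threshold -/L -[in RHS](gtr0_norm s0) -sqrtr_sqr.
by rewrite -sqrtrM ?sqr_ge0//; congr Num.sqrt; ring.
Qed.

Lemma aq1E (R : realType) (p s : nat) (sigma q : R) (L := ln (p%:R / s%:R - 1)) :
  0 < sigma -> aq1 p s sigma q =
    sigma * std_threshold q L + sigma * Num.sqrt (q * ln L).
Proof.
move=> s0; rewrite /aq1 /std_threshold -/L -[in RHS](gtr0_norm s0) -sqrtr_sqr.
by rewrite -!sqrtrM ?sqr_ge0//; congr (Num.sqrt _ + Num.sqrt _); ring.
Qed.

Lemma expR_threshold (R : realType) (q L : R) : 1 <= q -> 1 <= L ->
  expR (- (std_threshold q L ^+ 2 / 2)) = (expR L * L `^ (q / 2))^-1.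
Proof.
move=> q1 L1; have := mulr_ge0 (le_trans ler01 q1) (ln_ge0 L1) => qlnL0.
rewrite /std_threshold sqr_sqrtr; last lra.
have -> : - ((2 * L + q * ln L) / 2) = - L + - (q * ln L / 2) by lra.
by rewrite expRD expRN expR_half_ln ?invfM//; lra.
Qed.

(** Since [ln L <= L], the threshold is at most [sqrt ((2 + q) * L)], and the extra 1 is absorbed by
    [sqrt L >= 1]. *)
Lemma threshold_pow_le (R : realType) (q L : R) : 1 <= q -> 1 <= L ->
  (1 + std_threshold q L) `^ q <= (1 + Num.sqrt (2 + q)) `^ q * L `^ (q / 2).
Proof.
move=> q1 L1; have qlnL0 := mulr_ge0 (le_trans ler01 q1) (ln_ge0 L1).
have L0 : 0 <= L by lra.
have tD : 1 + std_threshold q L <= (1 + Num.sqrt (2 + q)) * Num.sqrt L.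
  have sL : 1 <= Num.sqrt L by rewrite -(@sqrtr1 R) ler_wsqrtr.
  suff : std_threshold q L <= Num.sqrt (2 + q) * Num.sqrt L by lra.
  rewrite -sqrtrM; last lra.
  apply: ler_wsqrtr.
  have := ln_sublinear (lt_le_trans ltr01 L1); nra.
rewrite -sqrt_powR// -powRM ?addr_ge0 ?sqrtr_ge0//.
apply: ge0_ler_powR => //; first lra.
- by rewrite nnegrE addr_ge0 ?sqrtr_ge0.
- by rewrite nnegrE mulr_ge0 ?sqrtr_ge0// addr_ge0 ?sqrtr_ge0.
Qed.

(** The iterated logarithm in the threshold is there for this cancellation: it contributes
    [L ^ (- q / 2)] to the exponential, exactly offsetting the growth of the power. *)
Lemma threshold_pow_expR_le (R : realType) (q L : R) : 1 <= q -> 1 <= L ->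
  (1 + std_threshold q L) `^ q * expR (- (std_threshold q L ^+ 2 / 2)) <=
  (1 + Num.sqrt (2 + q)) `^ q / expR L.
Proof.
move=> q1 L1; have Lq : 0 < L `^ (q / 2) by rewrite powR_gt0//; lra.
rewrite expR_threshold// invfM mulrCA mulrC ler_wpM2r ?invr_ge0 ?expR_ge0//.
by rewrite ler_pdivrMr// threshold_pow_le.
Qed.

Lemma powR_threshold_le (R : realType) (q L : R) : 1 <= q -> 1 <= L ->
  std_threshold q L `^ q <= (1 + Num.sqrt (2 + q)) `^ q * L `^ (q / 2).
Proof.
move=> q1 L1; apply: le_trans (threshold_pow_le q1 L1); apply: ge0_ler_powR => //; first lra.
- by rewrite nnegrE sqrtr_ge0.
- by rewrite nnegrE addr_ge0 ?sqrtr_ge0.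
- by rewrite lerDr.
Qed.

(* Applied with [W = 1] for strong signals ([r^2 = q ln L]) and with
   [W = (2 L)^(q / 2)], [r = 0] otherwise. *)
Lemma risk_bound_le (R : realType) (q L p s sg r W : R)
    (t := std_threshold q L) (D := 1 + Num.sqrt (2 + q))
    (K := 4 * expR (q ^+ 2)) : 1 <= q -> 1 <= L ->
  0 <= s -> 0 <= p <= 2 * s * expR L -> 1 <= W ->
  L `^ (q / 2) * expR (- (r ^+ 2 / 2)) <= W ->
  p * (sg `^ q * (4 * expR (q ^+ 2) * (1 + t) `^ q * expR (- (t ^+ 2 / 2)))) +
  s * (2 `^ q * sg `^ q *
    (4 * expR (q ^+ 2) + t `^ q * (4 * expR (- (r ^+ 2 / 2))))) <=
  (2 * K * D `^ q + 2 `^ q * (K + 4 * D `^ q)) * (s * sg `^ q * W).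
Proof.
move=> q1 L1 s0 /andP[p0 ps] W1 rW; rewrite -/K.
have K0 : 0 <= K by rewrite /K mulr_ge0 ?expR_ge0.
have Dq : 0 <= D `^ q := powR_ge0 _ _.
have sq : 0 <= sg `^ q := powR_ge0 _ _.
have twoq : 0 <= 2 `^ q :> R := powR_ge0 _ _.
(* The [p] null coordinates cost only order [s]: [p <= 2 * s * expR L] meets the factor
   [1 / expR L]. *)
have null : p * ((1 + t) `^ q * expR (- (t ^+ 2 / 2))) <= 2 * s * D `^ q.
  apply: (@le_trans _ _ (2 * s * expR L * (D `^ q / expR L))).
    by rewrite ler_pM ?mulr_ge0 ?powR_ge0 ?expR_ge0// threshold_pow_expR_le.
  by rewrite mulrA (mulrAC _ (expR L)) mulfK// gt_eqF ?expR_gt0.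
have signal : t `^ q * expR (- (r ^+ 2 / 2)) <= D `^ q * W.
  apply: (@le_trans _ _ (D `^ q * (L `^ (q / 2) * expR (- (r ^+ 2 / 2))))).
    by rewrite mulrA ler_wpM2r ?expR_ge0// powR_threshold_le.
  by rewrite ler_wpM2l.
have -> : p * (sg `^ q * (K * (1 + t) `^ q * expR (- (t ^+ 2 / 2)))) =
  sg `^ q * K * (p * ((1 + t) `^ q * expR (- (t ^+ 2 / 2)))) by ring.
have -> : s * (2 `^ q * sg `^ q *
    (K + t `^ q * (4 * expR (- (r ^+ 2 / 2))))) =
  s * sg `^ q * 2 `^ q * (K + 4 * (t `^ q * expR (- (r ^+ 2 / 2)))) by ring.
have -> : (2 * K * D `^ q + 2 `^ q * (K + 4 * D `^ q)) * (s * sg `^ q * W) =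
  sg `^ q * K * (2 * s * D `^ q * W) +
  s * sg `^ q * 2 `^ q * (K * W + 4 * (D `^ q * W)) by ring.
(* The terms that carry no [W] on the left gain it from [1 <= W]. *)
apply: lerD; apply: ler_wpM2l; rewrite ?mulr_ge0//.
  by apply: le_trans null _; rewrite ler_peMr// !mulr_ge0.
by apply: lerD; [rewrite ler_peMr | rewrite ler_wpM2l].
Qed.

(** * The risk bound in the two regimes of signal strength *)

Theorem theorem12 (R : realType) (q : R) (hq : 1 <= q) :
  exists C : R, 0 < C /\
  forall (p s : nat) (sigma a : R),
    (0 < s)%N -> (4 * s < p)%N -> 0 < sigma -> 0 < a ->
  forall (d : measure_display) (T : measurableType d) (P : probability T R)
         (xi : 'I_p -> {RV P >-> R}),
    (forall j, distribution P (xi j) = normal_prob 0 1 :> (set R -> \bar R)) ->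
    mutually_independent xi ->
  forall beta : 'I_p -> R, beta \in Omega s a ->
    (\int[P]_w (\sum_(j < p)
        `| hard_thr (tstar p s sigma q) (beta j + sigma * xi j w) - beta j | `^ q)%:E
     <= C%:E * Phi_ad p s sigma q a)%E.
Proof.
set K : R := 4 * expR (q ^+ 2); set D : R := 1 + Num.sqrt (2 + q).
set A : R := 2 * K * D `^ q + 2 `^ q * (K + 4 * D `^ q).
have K0 : 0 < K by rewrite /K mulr_gt0 ?expR_gt0.
have q0 : 0 < q by lra.
have D0 : 0 < D by rewrite /D ltr_pwDl ?sqrtr_ge0.
have A0 : 0 < A.
  have Dq : 0 < D `^ q by exact: powR_gt0.
  have twoq : 0 < 2 `^ q :> R by exact: powR_gt0.
  by rewrite /A addr_gt0// !mulr_gt0 ?addr_gt0 ?mulr_gt0 ?expR_gt0.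
have two1 : 1 <= 2 `^ q :> R.
  by rewrite -[leLHS](powRr0 2); apply: ler_powR => //; lra.
exists (A * (2 * 2 `^ q)); split; first by rewrite !mulr_gt0 ?powR_gt0.
move=> p s sigma a s0 sp sg0 a0 d T P xi dxi _ beta.
rewrite inE => -[bs ba].
have sR : 0 < s%:R :> R by rewrite ltr0n.
set M : R := p%:R / s%:R - 1; set L := ln M.
have M3 : 3 < M.
  rewrite /M ltrBrDr ltr_pdivlMr//; have -> : 3 + 1 = 4%:R :> R by lra.
  by rewrite -natrM ltr_nat.
have L1 : 1 <= L by rewrite ln_ge1// ltW.
(* Here [expR L = M] and [p = s * (M + 1)], with [M + 1 <= 2 * M]. *)
have pM : 0 <= (p%:R : R) <= 2 * s%:R * expR L.
  apply/andP; split; first exact: ler0n.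
  rewrite /L lnK ?posrE; last lra.
  have : p%:R = s%:R * (M + 1) by rewrite /M subrK mulrC divfK// gt_eqF.
  by move=> ->; nra.
have Lq1 : 1 <= L `^ (q / 2).
  apply: (@le_trans _ _ (1 `^ (q / 2))); first by rewrite powR1.
  by apply: ge0_ler_powR; rewrite ?nnegrE//; lra.
have lnL0 : 0 <= ln L by exact: ln_ge0.
rewrite tstarE// -/M -/L /Phi_ad aq1E// -/M -/L; case: ifPn => [ale|_].
(* Strong signals: [aq1] is the threshold plus [sigma * r], and [expR (- r^2 / 2)] is exactly the
   inverse of [L ^ (q / 2)]. *)
- set r := Num.sqrt (q * ln L) in ale.
  have rb j : beta j != 0 ->
      r = 0 \/ sigma * std_threshold q L + sigma * r <= `|beta j|.
    by move=> bj; right; apply: le_trans ale _; exact: ba.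
  apply: le_trans (total_risk_le dxi q0 sg0 (sqrtr_ge0 _) (sqrtr_ge0 _) bs rb) _.
  apply: (@le_trans _ _ (A * (s%:R * sigma `^ q * 1))%:E).
    rewrite lee_fin; apply: risk_bound_le => //.
    rewrite /r sqr_sqrtr ?mulr_ge0 ?(ltW q0)// expR_half_ln; last lra.
    by rewrite mulfV// gt_eqF//; lra.
  have -> : A * (s%:R * sigma `^ q * 1) =
      A * (2 * 2 `^ q) * s%:R * (2^-1 * (sigma / 2) `^ q).
    have -> : sigma `^ q = 2 `^ q * (sigma / 2) `^ q.
      by rewrite -powRM//; [congr (_ `^ _); field | rewrite divr_ge0// ltW].
    by field.
  rewrite [leLHS]EFinM muleA -(EFinM (A * _)) lee_wpmul2l//.
    by rewrite lee_fin !mulr_ge0 ?powR_ge0 ?ler0n// ltW.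
  exact: sigma_qq_ge (ltW q0) sg0.
(* No margin over the threshold is available: with [r = 0] the tail factor is 1, and [L ^ (q / 2)]
   stays in the bound, as the rate allows. *)
- have rb j : beta j != 0 ->
      0 = 0 :> R \/ sigma * std_threshold q L + sigma * 0 <= `|beta j|.
    by left.
  apply: le_trans (total_risk_le dxi q0 sg0 (sqrtr_ge0 _) (lexx 0) bs rb) _.
  rewrite -EFinM lee_fin.
  apply: (@le_trans _ _ (A * (s%:R * sigma `^ q * (2 * L) `^ (q / 2)))).
    have L2 : L `^ (q / 2) <= (2 * L) `^ (q / 2).
      by apply: ge0_ler_powR; rewrite ?nnegrE//; lra.
    apply: risk_bound_le => //; first exact: le_trans L2.
    by rewrite expr0n/= mul0r oppr0 expR0 mulr1.
  rewrite ler_wpM2r ?mulr_ge0 ?powR_ge0 ?ler0n// ler_peMr//; first exact: ltW.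
  by lra.
Qed.
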